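(* Let $R$ be a finite non-commutative ring and let $r\in R$. Then $\mathrm{Pr}_r(R) \leq \mathrm{Pr}(R)$, with equality if and only if $r=0$.
   Context: For a ring $R$ and $x,y\in R$, the commutator is $[x,y] := xy-yx$. For a finite ring $R$ and $r\in R$, $\mathrm{Pr}_r(R) := \frac{|\{(x,y)\in R\times R : [x,y]=r\}|}{|R\times R|}$, and $\mathrm{Pr}(R) := \frac{|\{(x,y)\in R\times R : xy=yx\}|}{|R\times R|}$ is the commuting probability of $R$. *)

(* Defs.v *)
From HB Require Import structures.
From mathcomp Require Import all_boot all_order all_algebra.

Set Implicit Arguments.
Unset Strict Implicit.
Unset Printing Implicit Defensive.

Import GRing.Theory.

Local Open Scope ring_scope.

(* All the ring structures of ssralg have a 1.  Here a ring is an associative  *)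
(* ring that need not have an identity; every finite unital ring is one (see   *)
(* [as_rng] below).                                                            *)
HB.mixin Record Zmodule_isRng R of GRing.Zmodule R := {
  rng_mul : R -> R -> R;
  rng_mulA : associative rng_mul;
  rng_mulDl : left_distributive rng_mul +%R;
  rng_mulDr : right_distributive rng_mul +%R
}.

#[short(type="finRngType")]
HB.structure Definition FinRng := {R of FinRing.Zmodule R & Zmodule_isRng R}.

Notation "x ** y" := (rng_mul x y) (at level 40, left associativity) : ring_scope.

Definition as_rng (R : finPzRingType) : Type := R.
HB.instance Definition _ (R : finPzRingType) :=
  FinRing.Zmodule.on (as_rng R).
HB.instance Definition _ (R : finPzRingType) :=
  Zmodule_isRng.Build (as_rng R)
    (@mulrA R) (@mulrDl R) (@mulrDr R).

Definition noncommutative (R : finRngType) : Prop :=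
  ~ commutative (@rng_mul R).

Definition commutator (R : finRngType) (x y : R) : R := x ** y - y ** x.

Definition Pr_at (R : finRngType) (r : R) : rat :=
  #|[set p : R * R | commutator p.1 p.2 == r]|%:R / #|{: R * R}|%:R.

Definition Pr (R : finRngType) : rat :=
  #|[set p : R * R | p.1 ** p.2 == p.2 ** p.1]|%:R / #|{: R * R}|%:R.

(* Main.v *)
(* For fixed x the map y |-> [x, y] is additive, so its fibre over r is empty *)
(* or a coset of its fibre over 0; summing over x gives the inequality.  If r *)
(* is nonzero, the fibre over r at x = 0 is empty while the one over 0 is R.  *)
Require Import Defs.
From HB Require Import structures.
From mathcomp Require Import all_boot all_order all_algebra.

Set Implicit Arguments.
Unset Strict Implicit.
Unset Printing Implicit Defensive.

Local Open Scope ring_scope.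

Import Order.TTheory GRing.Theory Num.Theory.

(** By [Pr_at0], both probabilities are fibre counts of the commutator, which
    [card_commutator_pairs] splits into rows of fixed [x]. In each row, [leq_card_commutator_fiber]
    bounds the fibre over [r] by the centralizer of [x]. For nonzero [r], the single row [x = 0]
    already makes the total strictly smaller. *)

Lemma rng_mul0r (R : finRngType) (y : R) : 0 ** y = 0.
Proof. by apply: (addrI (0 ** y)); rewrite -rng_mulDl !addr0. Qed.

Lemma rng_mulr0 (R : finRngType) (x : R) : x ** 0 = 0.
Proof. by apply: (addrI (x ** 0)); rewrite -rng_mulDr !addr0. Qed.

Lemma commutator0r (R : finRngType) (y : R) : commutator 0 y = 0.
Proof. by rewrite /commutator rng_mul0r rng_mulr0 subr0. Qed.

Lemma commutatorDr (R : finRngType) (x y z : R) :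
  commutator x (y + z) = commutator x y + commutator x z.
Proof. by rewrite /commutator rng_mulDl rng_mulDr opprD addrACA. Qed.

Lemma commutatorBr (R : finRngType) (x y z : R) :
  commutator x (y - z) = commutator x y - commutator x z.
Proof. by apply: (addIr (commutator x z)); rewrite -commutatorDr !subrK. Qed.

Lemma leq_card_commutator_fiber (R : finRngType) (x r : R) :
  (#|[set y | commutator x y == r]| <= #|[set y | commutator x y == 0%R]|)%N.
Proof.
have [->|[y0]] := set_0Vmem [set y | commutator x y == r]; first by rewrite cards0.
(* Translation by [- y0] is injective and carries the fibre over [r] into the fibre over 0. *)
rewrite inE => /eqP xy0; rewrite -(card_imset _ (addIr (- y0))).
apply/subset_leq_card/subsetP => _ /imsetP[y + ->].
by rewrite !inE commutatorBr xy0 => /eqP->; rewrite subrr.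
Qed.

Lemma card_commutator_pairs (R : finRngType) (r : R) :
  #|[set p : R * R | commutator p.1 p.2 == r]| =
  (\sum_(x : R) #|[set y | commutator x y == r]|)%N.
Proof.
under eq_bigr => x _ do rewrite -sum1_card.
rewrite pair_big_dep -sum1_card.
by apply: eq_bigl => -[x y]; rewrite !inE.
Qed.

Lemma Pr_at0 (R : finRngType) : Pr_at (0 : R) = Pr R.
Proof.
by congr (_%:R / _); apply: eq_card => p; rewrite !inE subr_eq0.
Qed.

Lemma le_Pr_at (R : finRngType) (r : R) : Pr_at r <= Pr R.
Proof.
rewrite -Pr_at0 ler_wpM2r ?invr_ge0 ?ler0n // ler_nat !card_commutator_pairs.
by apply: leq_sum => x _; apply: leq_card_commutator_fiber.
Qed.

Lemma lt_Pr_at (R : finRngType) (r : R) : r != 0 -> Pr_at r < Pr R.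
Proof.
move=> r_neq0; have cardRR_gt0 : (0 < #|{: R * R}|)%N by apply/card_gt0P; exists 0.
rewrite -Pr_at0 ltr_pM2r ?invr_gt0 ?ltr0n // ltr_nat !card_commutator_pairs.
(* Isolate the row [x = 0] on both sides; [addSn] puts the successor hidden in the strict inequality
   on that row, so the other rows need only the weak bound. *)
rewrite (bigD1 0) //= [ltnRHS](bigD1 0) //= -addSn.
apply: leq_add; last by apply: leq_sum => x _; apply: leq_card_commutator_fiber.
rewrite (_ : [set y | commutator 0 y == r] = set0) ?cards0.
  by apply/card_gt0P; exists 0; rewrite inE commutator0r.
by apply/setP => y; rewrite !inE commutator0r eq_sym (negbTE r_neq0).
Qed.

Theorem proposition2p9 (R : finRngType) (r : R) (ncR : noncommutative R) :
  Pr_at r <= Pr R /\ (Pr_at r = Pr R <-> r = 0).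
Proof.
split; first exact: le_Pr_at.
split=> [PrE|->]; last exact: Pr_at0.
by apply/eqP/negPn/negP => /lt_Pr_at; rewrite PrE ltxx.
Qed.
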